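(* Let $r\ge 1$, $q=2^r$, and let $R=\mathrm{GR}(4,r)$ be the Galois ring of characteristic $4$, order $q^2$ and residue field $\mathbb{F}_q$. Let $k\ge 2$ be an integer, and let $s\in\{0,2,4,\dots,(k-1)r\}$ if $k$ is odd, and $s\in\{r,r+2,r+4,\dots,(k-1)r\}$ if $k$ is even. Let $\mathcal{T}=\mathcal{T}_{q,k,s}$ be the generalized Teichmüller code: a regular, projective $R$-linear code of length $n=2^s\cdot\frac{q^k-1}{q-1}$ whose nonzero codewords have homogeneous weights $$2^sq^k-2^{s/2}q^{(k-1)/2},\qquad 2^sq^k,\qquad 2^sq^k+2^{s/2}q^{(k-1)/2}$$ with respective frequencies $$\tfrac12(q^k-1)\bigl(q^k+2^{s/2}q^{(k+1)/2}\bigr),\qquad q^k-1,\qquad \tfrac12(q^k-1)\bigl(q^k-2^{s/2}q^{(k+1)/2}\bigr).$$ Then the coset graph of $\mathcal{T}^\bot$ with $b=2^sq$ loops added at each vertex is a $3$-SWRG.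
   Context: $R=\mathrm{GR}(4,r)$ is a chain ring of depth $2$ with maximal ideal $2R$. The homogeneous weight on $R$ is $\mathrm{w}_{\mathrm{hom}}(0)=0$, $\mathrm{w}_{\mathrm{hom}}(x)=q$ for $0\neq x\in 2R$, and $\mathrm{w}_{\mathrm{hom}}(x)=q-1$ for $x\in R^\times$, extended additively to $R^n$. A linear code of length $n$ with $\ell\times n$ generator matrix $[g_1|\cdots|g_n]$ is regular if $\{x\cdot g_i: x\in R^\ell\}=R$ for every $i$, and projective if $Rg_i\ne Rg_j$ for all $i\neq j$. Only the listed parameters of $\mathcal{T}_{q,k,s}$ matter for the statement. The dual code is taken with respect to the standard inner product. The coset graph of a linear code $C\subseteq R^n$ has as vertices the cosets of $C$ in $R^n$; two cosets are adjacent iff their difference is a coset $ue_i+C$ with $u\in R^\times$ and $e_i$ a standard unit vector. A graph (possibly with loops) is a $3$-SWRG (strongly walk-regular graph) if there are integers $\lambda,\mu,\nu$ such that the number of walks of length $3$ from $x$ to $y$ is $\lambda$ if $x\neq y$ are adjacent, $\mu$ if $x\ne y$ are non-adjacent, and $\nu$ if $x=y$. *)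

(* Defs.v *)
From HB Require Import structures.
From mathcomp Require Import all_boot all_order all_algebra.

Set Implicit Arguments.
Unset Strict Implicit.
Unset Printing Implicit Defensive.

Import GRing.Theory.
Local Open Scope ring_scope.

(* R is (isomorphic to) GR(4, r) = (Z/4)[X] / (f), where f is monic of degree *)
(* r and basic irreducible, i.e. irreducible modulo 2.  The isomorphism is    *)
(* given as a surjection from (Z/4)[X] onto R with kernel (f).                *)
Definition mod2 (a : 'Z_4) : 'F_2 := (a : nat)%:R.

Definition is_GR4 (r : nat) (R : finComUnitRingType) : Prop :=
  exists (f : {poly 'Z_4}) (phi : {rmorphism {poly 'Z_4} -> R}),
    [/\ f \is monic, size f = r.+1, irreducible_poly (map_poly mod2 f),
        (forall a : R, exists p, phi p = a)
      & (forall p, phi p = 0 <-> exists g, p = g * f)].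

Section Codes.

Variable R : finComUnitRingType.

(* Normalised for residue field of order q.  In GR(4, r), the complement of   *)
(* 2R is the set of units.                                                    *)
Definition whom (q : nat) (x : R) : nat :=
  if x == 0 then 0%N
  else if [exists y : R, x == 2%:R * y] then q
  else (q - 1)%N.

Definition whomv (q n : nat) (c : 'rV[R]_n) : nat :=
  (\sum_(i < n) whom q (c 0 i)%R)%N.

(* Every linear code in R^n is of this form, as R is finite. *)
Definition code_of l n (G : 'M[R]_(l, n)) : {set 'rV[R]_n} :=
  [set x *m G | x in [set: 'rV[R]_l]].

Definition regular_gen l n (G : 'M[R]_(l, n)) : Prop :=
  forall i : 'I_n, [set (x *m col i G) 0 0 | x in [set: 'rV[R]_l]] = [set: R].

Definition projective_gen l n (G : 'M[R]_(l, n)) : Prop :=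
  forall i j : 'I_n, i != j ->
    [set a *: col i G | a in [set: R]] <> [set a *: col j G | a in [set: R]].

Definition weight_freq (q n : nat) (C : {set 'rV[R]_n}) (w : nat) : nat :=
  #|[set c in C | (c != 0) && (whomv q c == w)]|.

Definition dual_code n (C : {set 'rV[R]_n}) : {set 'rV[R]_n} :=
  [set y : 'rV[R]_n | [forall c in C, \sum_(i < n) c 0 i * y 0 i == 0]].

Definition code_coset n (C : {set 'rV[R]_n}) (x : 'rV[R]_n) :
    {set 'rV[R]_n} :=
  [set x + c | c in C].

Definition code_cosets n (C : {set 'rV[R]_n}) : {set {set 'rV[R]_n}} :=
  [set code_coset C x | x in [set: 'rV[R]_n]].

Definition coset_vertex n (C : {set 'rV[R]_n}) : finType :=
  {X : {set 'rV[R]_n} | X \in code_cosets C}.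

Definition coset_adj n (C : {set 'rV[R]_n}) (X Y : coset_vertex C) : bool :=
  [exists u : R, exists i : 'I_n,
     (u \is a GRing.unit) &&
     ([set x - y | x in val X, y in val Y]
        == code_coset C (u *: delta_mx 0 i))].

End Codes.

(* A finite graph with multiple edges and loops, given by its adjacency       *)
(* matrix: M x y is the number of edges from x to y, each loop at x counting  *)
(* once in M x x.                                                             *)
Definition multigraph (V : finType) : Type := V -> V -> nat.

Definition coset_graph (R : finComUnitRingType) n (C : {set 'rV[R]_n}) :
    multigraph (coset_vertex C) :=
  fun X Y => coset_adj X Y.
Arguments coset_graph {R n} C X Y.

Definition add_loops (V : finType) (b : nat) (M : multigraph V) :
    multigraph V :=
  fun x y => (M x y + (if x == y then b else 0))%N.

(* Walks are sequences of edges, so parallel edges give distinct walks. *)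
Fixpoint walks (V : finType) (M : multigraph V) (l : nat) (x y : V) : nat :=
  if l is l'.+1 then (\sum_(z : V) M x z * walks M l' z y)%N else x == y.

Definition is_SWRG (l : nat) (V : finType) (M : multigraph V) : Prop :=
  exists lambda mu nu : nat, forall x y : V,
    walks M l x y =
      if x == y then nu else if (0 < M x y)%N then lambda else mu.

(* The exponents s / 2 and (k -+ 1) / 2 need not be integers separately, but  *)
(* under admissible k r s below both sums of exponents of 2 are even, so that *)
(* half_pow r s (k - 1) = 2 ^ (s / 2) * q ^ ((k - 1) / 2) for q = 2 ^ r, and  *)
(* similarly with k + 1.                                                      *)
Definition half_pow (r s m : nat) : nat := (2 ^ ((s + r * m)./2))%N.

Definition admissible (k r s : nat) : bool :=
  if odd k then ~~ odd s && (s <= (k - 1) * r)%N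
  else [&& odd s == odd r, (r <= s)%N & (s <= (k - 1) * r)%N].

(* For admissible k r s with r >= 1 and q = 2 ^ r, no subtraction below       *)
(* truncates and both halvings are exact.                                     *)
Definition teichmuller_weights (R : finComUnitRingType) (r k s n : nat)
    (C : {set 'rV[R]_n}) : Prop :=
  let q := (2 ^ r)%N in
  let w1 := (2 ^ s * q ^ k - half_pow r s (k - 1))%N in
  let w2 := (2 ^ s * q ^ k)%N in
  let w3 := (2 ^ s * q ^ k + half_pow r s (k - 1))%N in
  [/\ (forall c, c \in C -> c != 0 -> whomv q c \in [:: w1; w2; w3]),
      weight_freq q C w1
        = ((q ^ k - 1) * (q ^ k + half_pow r s (k + 1)))./2,
      weight_freq q C w2 = (q ^ k - 1)%N
    & weight_freq q C w3
        = ((q ^ k - 1) * (q ^ k - half_pow r s (k + 1)))./2].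

(* Main.v *)
From HB Require Import structures.
Require Import Defs.
From mathcomp Require Import all_boot all_order all_algebra.
From mathcomp Require Import algC.

Set Implicit Arguments.
Unset Strict Implicit.
Unset Printing Implicit Defensive.

Import GRing.Theory Num.Theory.

(** The coset graph of the dual of a code C is the Cayley graph of the finite
    abelian group R^n / C^perp, whose characters are indexed by the codewords.
    Once R has an additive character chi that is nontrivial on every nonzero
    ideal, the characters of this group are z |-> chi (<c, z>) for c in C, and
    [walks_spectral] writes the number of walks of length m from x to y as
      (1 / N) * sum over t in R^l of theta (t G)^m * chi (<t G, x - y>),
    where N = #|R^l| and theta (c) is the sum of chi (u c_i) over the units u
    and the positions i, plus the number b of loops.  Averaging over messages t
    instead of codewords only counts each codeword with the same multiplicity.

    Regularity and projectivity of the generator matrix make the cosets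
    u e_i + C^perp, for units u, pairwise distinct and different from C^perp
    ([unit_multiples_distinct], [dual_unit_multiple]); hence the graph is
    simple and its adjacency is the plain sum over pairs (u, i).

    Over GR(4, r) the sum of chi (u y) over the units u equals
    q (q - 1) - q w_hom(y) ([sum_char_units]), so that
      theta (c) = n q (q - 1) - q w_hom(c) + b.
    For the length n = 2^s (q^k - 1) / (q - 1) and b = 2^s q loops this is
    q (2^s q^k - w_hom(c)): the three weights of nonzero codewords give the
    eigenvalues 0 and +- q h, with h the gap between consecutive weights.  All
    of them are roots of theta^3 = (q h)^2 theta.  For the adjacency matrix M
    with loops, M^3 - (q h)^2 M therefore only sees the zero codeword: all its
    entries are equal, which is the 3-SWRG property ([SWRG_of_eigenvalues]). *)

(** * Galois rings of characteristic 4 *)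

Section GaloisRing.
Local Open Scope ring_scope.

Lemma mod2_is_zmod_morphism : zmod_morphism mod2.
Proof.
by move=> [[|[|[|[|]]]]] // ? [[|[|[|[|]]]]] // ?; apply/eqP.
Qed.

Lemma mod2_is_monoid_morphism : monoid_morphism mod2.
Proof.
by split=> [|[[|[|[|[|]]]]] // ? [[|[|[|[|]]]]] // ?]; apply/eqP.
Qed.

HB.instance Definition _ :=
  GRing.isZmodMorphism.Build 'Z_4 'F_2 mod2 mod2_is_zmod_morphism.
HB.instance Definition _ :=
  GRing.isMonoidMorphism.Build 'Z_4 'F_2 mod2 mod2_is_monoid_morphism.

Definition lift2 (a : 'F_2) : 'Z_4 := (a : nat)%:R.

Lemma mod2_lift2 : cancel lift2 mod2.
Proof. by move=> [[|[|]]] // ?; apply/eqP. Qed.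

Lemma map_mod2_lift2 (p : {poly 'F_2}) : map_poly mod2 (map_poly lift2 p) = p.
Proof.
by apply/polyP=> i; rewrite coef_map coef_map_id0 /= ?mod2_lift2 //.
Qed.

(** Even residues are halved coefficient by coefficient: 0 = 2 * 0 and
    2 = 2 * 1 in Z/4. *)
Lemma map_mod2_eq0 (p : {poly 'Z_4}) :
  map_poly mod2 p = 0 -> exists h, p = 2%:R * h.
Proof.
have half a : (mod2 a == 0) ==> (a == (a./2)%:R *+ 2).
  by case: a => [[|[|[|[|]]]]].
move=> p0; exists (map_poly (fun a : 'Z_4 => (a./2)%:R) p).
apply/polyP=> i; rewrite mulr_natl coefMn coef_map_id0; last by apply/eqP.
by apply/eqP; apply: (implyP (half _)); rewrite -coef_map p0 coef0.
Qed.

(** The properties of GR(4, r), for q = 2 ^ r, on which the character sums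
    depend.  That q is the order of the residue field is a consequence, see
    [card_I2]. *)
Definition depth2_chain_ring (q : nat) (R : finComUnitRingType) : Prop :=
  [/\ 2%:R != 0 :> R, 4%:R = 0 :> R,
      forall a : R, a \isn't a GRing.unit <-> exists b, a = 2%:R * b
    & #|R| = (q ^ 2)%N].

Section Presentation.
Variables (r : nat) (R : finComUnitRingType).
Variables (f : {poly 'Z_4}) (phi : {rmorphism {poly 'Z_4} -> R}).
Hypotheses (f_monic : f \is monic) (size_f : size f = r.+1).
Hypothesis (f_irr : irreducible_poly (map_poly mod2 f)).
Hypothesis phi_surj : forall a : R, exists p, phi p = a.
Hypothesis phi_ker : forall p, phi p = 0 <-> exists g, p = g * f.

(* Remainders modulo the monic polynomial f are canonical representatives of
   the elements of R. *)
Local Notation rem p := (Pdiv.CommonRing.rmodp p f).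

Lemma phi_f : phi f = 0.
Proof. by apply/phi_ker; exists 1; rewrite mul1r. Qed.

Lemma r_gt0 : (0 < r)%N.
Proof.
have := f_irr.1; rewrite size_map_poly_id0 ?size_f //.
by rewrite (eqP f_monic) rmorph1 oner_eq0.
Qed.

Lemma phi_rem p : phi (rem p) = phi p.
Proof.
rewrite [in RHS](Pdiv.RingMonic.rdivp_eq f_monic p) rmorphD rmorphM /= phi_f.
by rewrite mulr0 add0r.
Qed.

Lemma rem_inj p p' : phi p = phi p' -> rem p = rem p'.
Proof.
move=> /eqP; rewrite -subr_eq0 -rmorphB => /eqP/phi_ker[g pp'].
by rewrite -(subrK p' p) Pdiv.RingMonic.rmodpD // pp'
           Pdiv.RingMonic.rmodp_mull // add0r.
Qed.

Lemma size_rem p : (size (rem p) <= r)%N.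
Proof.
by have := Pdiv.Ring.ltn_rmodpN0 p (monic_neq0 f_monic); rewrite size_f ltnS.
Qed.

Lemma rem_small (p : {poly 'Z_4}) : (size p <= r)%N -> rem p = p.
Proof. by move=> ?; apply: Pdiv.Ring.rmodp_small; rewrite size_f ltnS. Qed.

(** Coefficient vectors of remainders are in bijection with R. *)
Lemma presentation_card : #|R| = ((2 ^ r) ^ 2)%N.
Proof.
have [sec secK] := fin_all_exists phi_surj.
have K1 : cancel (fun v : 'rV['Z_4]_r => phi (rVpoly v))
                 (fun a => poly_rV (rem (sec a))).
  move=> v; rewrite -[RHS]rVpolyK.
  rewrite -[in RHS](@rem_small (rVpoly v)) ?size_poly //; congr poly_rV.
  exact/rem_inj/secK.
have K2 : cancel (fun a => poly_rV (rem (sec a)))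
                 (fun v : 'rV['Z_4]_r => phi (rVpoly v)).
  by move=> a; rewrite poly_rV_K ?size_rem // phi_rem secK.
rewrite -(bij_eq_card (Bijective K1 K2)) card_mx card_ord mul1n.
by rewrite -expnM mulnC expnM.
Qed.

Lemma phi_C_neq0 (c : 'Z_4) : c != 0 -> phi c%:P != 0.
Proof.
move=> c0; apply/eqP=> e.
have := rem_inj (etrans e (esym (rmorph0 phi))).
rewrite !rem_small ?size_poly0 ?(leq_trans (size_polyC_leq1 _) r_gt0) //.
by move/eqP; rewrite polyC_eq0 (negPf c0).
Qed.

Lemma presentation_two_neq0 : 2%:R != 0 :> R.
Proof.
by rewrite -(rmorph_nat phi) -polyC_natr phi_C_neq0.
Qed.

Lemma presentation_four_eq0 : 4%:R = 0 :> R.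
Proof.
rewrite -(rmorph_nat phi) -polyC_natr.
by rewrite (_ : 4%:R = 0 :> 'Z_4) ?rmorph0 //; apply/eqP.
Qed.

(** Modulo 2, the polynomial p representing a is either coprime to the
    irreducible reduction of f, or divisible by it.  In the first case a lifted
    Bezout relation makes a invertible up to a factor 1 + 2w, whose inverse is
    1 - 2w; in the second p is a multiple of f up to an even polynomial. *)
Lemma presentation_nonunit (a : R) :
  a \isn't a GRing.unit <-> exists b, a = 2%:R * b.
Proof.
have two2 : 2%:R * 2%:R = 0 :> R by rewrite -natrM presentation_four_eq0.
split=> [aNunit|[b ->]]; last first.
  apply/negP=> u; have := presentation_two_neq0.
  by rewrite -(mulrI_eq0 _ (mulrI u)) mulrAC two2 mul0r eqxx.
have [p pa] := phi_surj a.
have [cop|ncop] := boolP (coprimep (map_poly mod2 p) (map_poly mod2 f)).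
  have [[u v] /= uv1] := Bezout_eq1_coprimepP _ _ cop.
  have [|w ew] := @map_mod2_eq0
    (map_poly lift2 u * p + map_poly lift2 v * f - 1).
    by rewrite rmorphB rmorph1 rmorphD !rmorphM /= !map_mod2_lift2 uv1 subrr.
  case/negP: aNunit; apply/unitrP.
  exists (phi (map_poly lift2 u) * (1 - 2%:R * phi w)).
  suff e: phi (map_poly lift2 u) * a * (1 - 2%:R * phi w) = 1.
    by split; rewrite -[RHS]e; [rewrite mulrAC | rewrite mulrCA mulrA].
  move/(congr1 phi): ew; rewrite rmorphB rmorph1 rmorphD !rmorphM /= phi_f.
  rewrite mulr0 addr0 pa rmorph_nat => /eqP; rewrite subr_eq => /eqP ->.
  rewrite [_ + 1]addrC mulrC -subr_sqr expr1n exprMn [2%:R ^+ 2]two2.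
  by rewrite mul0r subr0.
have f_dvd : map_poly mod2 f %| map_poly mod2 p.
  have := f_irr.2 _ _ (dvdp_gcdr (map_poly mod2 p) (map_poly mod2 f)).
  rewrite coprimep_def in ncop => /(_ ncop) fg.
  by rewrite -(eqp_dvdl _ fg) dvdp_gcdl.
have [|h eh] := @map_mod2_eq0
  (p - map_poly lift2 (map_poly mod2 p %/ map_poly mod2 f) * f).
  by rewrite rmorphB rmorphM /= map_mod2_lift2 divpK // subrr.
exists (phi h); move/(congr1 phi): eh.
by rewrite rmorphB !rmorphM /= phi_f mulr0 subr0 pa rmorph_nat.
Qed.

(** The constant coefficient of the remainder is an additive map T from R to
    Z/4 with T(2) = 2, so that i^T sends 2 to i^2 = -1. *)
Lemma presentation_character : exists chi : R -> algC,
  [/\ chi 0 = 1, forall a b, chi (a + b) = chi a * chi b & chi 2%:R = -1].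
Proof.
have [sec secK] := fin_all_exists phi_surj.
pose T a := (rem (sec a))`_0.
have Tphi p : T (phi p) = (rem p)`_0.
  by rewrite /T (rem_inj (secK _)).
have TD a b : T (a + b) = T a + T b.
  have [[p <-] [p' <-]] := (phi_surj a, phi_surj b).
  by rewrite -rmorphD !Tphi Pdiv.RingMonic.rmodpD // coefD.
have T_nat m : T m%:R = m%:R.
  rewrite -(rmorph_nat phi) Tphi -polyC_natr rem_small ?coefC //.
  exact: leq_trans (size_polyC_leq1 _) r_gt0.
have i4 : ('i : algC) ^+ 4 = 1 by rewrite (exprM _ 2 2) sqrCi sqrrN expr1n.
exists (fun a => 'i ^+ (T a : nat)); split=> [|a b|].
- by rewrite (T_nat 0%N) expr0.
- by rewrite TD -exprD -[RHS](expr_mod _ i4).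
- by rewrite T_nat -sqrCi.
Qed.
End Presentation.

Lemma GR4_depth2_chain_ring r R :
  is_GR4 r R -> depth2_chain_ring (2 ^ r) R.
Proof.
case=> f [phi [f_monic size_f f_irr surj ker]]; split.
- exact: (presentation_two_neq0 f_monic size_f f_irr ker).
- exact: (presentation_four_eq0 phi).
- by move=> a; apply: (presentation_nonunit f_monic size_f f_irr surj ker).
- exact: (presentation_card f_monic size_f surj ker).
Qed.

Lemma GR4_character r R : is_GR4 r R -> exists chi : R -> algC,
  [/\ chi 0 = 1, forall a b, chi (a + b) = chi a * chi b & chi 2%:R = -1].
Proof.
case=> f [phi [f_monic size_f f_irr surj ker]].
exact: (presentation_character f_monic size_f f_irr surj ker).
Qed.
End GaloisRing.

(** * Character sums and the homogeneous weight *)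

Section CharacterSums.
Local Open Scope ring_scope.

(** The sum is invariant under multiplication by psi t, because translation by
    t permutes A. *)
Lemma sum_char_eq0 (T : finZmodType) (A : {set T}) (psi : T -> algC) (t : T) :
    (forall x y, psi (x + y) = psi x * psi y) ->
    (forall x, (t + x \in A) = (x \in A)) -> psi t != 1 ->
  \sum_(x in A) psi x = 0.
Proof.
move=> psiD At psit; apply/eqP.
have /eqP : (psi t - 1) * \sum_(x in A) psi x = 0.
  rewrite mulrBl mul1r [X in _ - X](reindex_inj (addrI t)) /= mulr_sumr.
  apply/eqP; rewrite subr_eq0; apply/eqP.
  by apply: eq_big => x; rewrite ?At.
by rewrite mulf_eq0 subr_eq0 (negPf psit).
Qed.

Variables (q : nat) (R : finComUnitRingType) (chi : R -> algC).
Hypothesis R_chain : depth2_chain_ring q R.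
Hypotheses (chi0 : chi 0 = 1) (chiD : forall a b, chi (a + b) = chi a * chi b).
Hypothesis chi2 : chi 2%:R = -1.

Let two_neq0 : 2%:R != 0 :> R. Proof. by case: R_chain. Qed.
Let nonunitP (a : R) : a \isn't a GRing.unit <-> exists b, a = 2%:R * b.
Proof. by case: R_chain. Qed.
Let two2 (a : R) : 2%:R * (2%:R * a) = 0.
Proof. by rewrite mulrA -natrM; case: R_chain => _ -> _ _; rewrite mul0r. Qed.

Lemma mulr2_eq0 (a : R) : (2%:R * a == 0) = (a \isn't a GRing.unit).
Proof.
apply/idP/idP=> [|/nonunitP[b ->]]; last by rewrite two2.
by apply: contraL => u; rewrite mulIr_eq0 ?two_neq0 //; apply: mulIr.
Qed.

(** The minimal ideal of R is 2R, so a character that is nontrivial at 2 is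
    nontrivial on every nonzero ideal. *)
Lemma two_in_nonzero_ideal (y : R) : y != 0 -> exists a, a * y = 2%:R.
Proof.
move=> y0; have [uy|/nonunitP[z yz]] := boolP (y \is a GRing.unit).
  by exists (2%:R * y^-1); rewrite mulrVK.
have uz : z \is a GRing.unit by apply: contraNT y0; rewrite yz -mulr2_eq0.
by exists z^-1; rewrite yz mulrCA mulVr ?mulr1.
Qed.

Lemma char_generating (y : R) : y != 0 -> exists a, chi (a * y) != 1.
Proof.
move=> /two_in_nonzero_ideal[a ay]; exists a; rewrite ay chi2.
by rewrite eq_sym -subr_eq0 opprK -(natrD _ 1 1) pnatr_eq0.
Qed.

Local Notation I2 := [set 2%:R * a | a in [set: R]].

Lemma mem_I2 (a : R) : (a \in I2) = (a \isn't a GRing.unit).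
Proof.
by apply/imsetP/idP => [[b _ ->]|/nonunitP[b ->]]; [apply/nonunitP|]; exists b.
Qed.

(** Doubling maps R onto 2R, and its fibres are the cosets of its kernel, which
    is 2R again. *)
Lemma card_I2 : #|I2| = q.
Proof.
have : (#|I2| ^ 2 = q ^ 2)%N.
  case: R_chain => _ _ _ <-; rewrite -[RHS]sum1_card.
  rewrite (partition_big (fun a => 2%:R * a) (mem I2)) /=; last first.
    by move=> a _; apply: imset_f.
  rewrite -mulnn -sum_nat_const; apply: eq_bigr => _ /imsetP[b _ ->].
  rewrite sum1dep_card -[LHS](card_imset _ (addrI b)); apply: eq_card => a.
  rewrite !inE -subr_eq0 -mulrBr mulr2_eq0 -mem_I2.
  apply/imsetP/idP => [[v vI ->]|abI]; first by rewrite addrC addKr.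
  by exists (a - b); rewrite // addrC subrK.
by move/eqP; rewrite eqn_exp2r // => /eqP.
Qed.

(** The units are the complement of 2R.  The sum over R vanishes unless y = 0,
    and the sum over 2R vanishes exactly when y is a unit, that is, when
    2Ry <> 0.  The three resulting values q^2 - q, -q and 0 are affine in the
    homogeneous weight. *)
Lemma sum_char_units (y : R) :
  \sum_(u : R | u \is a GRing.unit) chi (u * y)
    = (q * (q - 1))%:R - (q * whom q y)%:R.
Proof.
have psiD a b : chi ((a + b) * y) = chi (a * y) * chi (b * y).
  by rewrite mulrDl chiD.
have q_gt0 : (0 < q)%N.
  by rewrite -card_I2; apply/card_gt0P; exists 0; rewrite mem_I2 unitr0.
have sumR : \sum_(a : R) chi (a * y) = if y == 0 then (q ^ 2)%:R else 0.
  have [->|y0] := eqVneq y 0.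
    under eq_bigr do rewrite mulr0 chi0.
    by rewrite sumr_const; case: R_chain => _ _ _ ->.
  have [t ty] := char_generating y0.
  transitivity (\sum_(a in [set: R]) chi (a * y)).
    by apply: eq_bigl => a; rewrite inE.
  by apply: (sum_char_eq0 (t := t)) => // x; rewrite !inE.
have sumI : \sum_(a in I2) chi (a * y)
    = if y \is a GRing.unit then 0 else q%:R.
  case: ifPn => uy.
    apply: (sum_char_eq0 (t := 2%:R * y^-1)) => // [x|].
      rewrite !mem_I2 -!mulr2_eq0 mulrDr.
      by rewrite two2 add0r.
    by rewrite mulrVK // chi2 eq_sym -subr_eq0 opprK -(natrD _ 1 1) pnatr_eq0.
  rewrite (eq_bigr (fun=> 1)); last first.
    move=> _ /imsetP[a _ ->]; rewrite -mulrA mulrCA.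
    by move: uy; rewrite -mulr2_eq0 => /eqP->; rewrite mulr0 chi0.
  by rewrite sumr_const card_I2.
have -> : \sum_(u : R | u \is a GRing.unit) chi (u * y)
    = (if y == 0 then (q ^ 2)%:R else 0)
      - (if y \is a GRing.unit then 0 else q%:R).
  rewrite -sumR -sumI [in RHS](bigID (mem I2)) /= addrC.
  rewrite addrK; apply: eq_bigl => u.
  by rewrite mem_I2 negbK.
have nunitE : [exists z, y == 2%:R * z] = (y \isn't a GRing.unit).
  apply/existsP/idP => [[z /eqP->]|/nonunitP[z ->]]; last by exists z.
  by apply/nonunitP; exists z.
rewrite /whom nunitE; have [->|y0] := eqVneq y 0.
  rewrite unitr0 muln0 subr0 mulnBr muln1 natrB ?mulnn //.
  by rewrite -mulnn leq_pmulr.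
case: ifP => _ /=; first by rewrite !subrr.
by rewrite sub0r -[RHS]opprB -natrB ?leq_mul ?leq_subr // -mulnBr subKn ?muln1.
Qed.

End CharacterSums.

(** * The coset graph of the dual code *)

Section CosetGraph.
Local Open Scope ring_scope.

Variables (R : finComUnitRingType) (l n : nat) (G : 'M[R]_(l, n)).
Variable chi : R -> algC.
Hypotheses (chi0 : chi 0 = 1) (chiD : forall a b, chi (a + b) = chi a * chi b).
Hypothesis chi_gen : forall y : R, y != 0 -> exists a, chi (a * y) != 1.
Hypotheses (G_reg : regular_gen G) (G_proj : projective_gen G).

Local Notation D := (dual_code (code_of G)).

(** The inner product of z with the codeword encoding the message t: summing
    over messages rather than codewords keeps all sums over full row spaces. *)
Definition pairing (t : 'rV[R]_l) (z : 'rV[R]_n) : R :=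
  \sum_(i < n) (t *m G) 0 i * z 0 i.

Lemma pairingDl t t' z : pairing (t + t') z = pairing t z + pairing t' z.
Proof.
by rewrite -big_split; apply: eq_bigr => i _; rewrite mulmxDl mxE mulrDl.
Qed.

Lemma pairingDr t z z' : pairing t (z + z') = pairing t z + pairing t z'.
Proof.
rewrite -big_split; apply: eq_bigr => i _.
by rewrite [fun_of_matrix (_ + _) _ _]mxE mulrDr.
Qed.

Lemma pairingNr t z : pairing t (- z) = - pairing t z.
Proof.
rewrite -sumrN; apply: eq_bigr => i _.
by rewrite [fun_of_matrix (- _) _ _]mxE mulrN.
Qed.

Lemma pairingZl a t z : pairing (a *: t) z = a * pairing t z.
Proof.
rewrite mulr_sumr; apply: eq_bigr => i _.
by rewrite -scalemxAl [fun_of_matrix (_ *: _) _ _]mxE mulrA.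
Qed.

Lemma pairing_delta t u i :
  pairing t (u *: delta_mx 0 i) = u * (t *m G) 0 i.
Proof.
have coord j : (u *: delta_mx 0 i : 'rV[R]_n) 0 j = u * (j == i)%:R.
  by rewrite !mxE eqxx.
rewrite /pairing (bigD1 i) //= coord eqxx mulr1 mulrC big1 ?addr0 // => j ji.
by rewrite coord (negPf ji) !mulr0.
Qed.

Lemma mem_dualP z : reflect (forall t, pairing t z = 0) (z \in D).
Proof.
rewrite inE; apply: (iffP forall_inP) => [h t|h _ /imsetP[t _ ->]].
  by apply/eqP/h/imset_f.
exact/eqP/h.
Qed.

Lemma dualD z z' : z \in D -> z' \in D -> z + z' \in D.
Proof.
move=> /mem_dualP Dz /mem_dualP Dz'; apply/mem_dualP=> t.
by rewrite pairingDr Dz Dz' addr0.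
Qed.

Lemma dualN z : z \in D -> - z \in D.
Proof.
by move=> /mem_dualP Dz; apply/mem_dualP=> t; rewrite pairingNr Dz oppr0.
Qed.

Lemma dual0 : 0 \in D.
Proof.
apply/mem_dualP=> t; rewrite /pairing big1 // => i _.
by rewrite [fun_of_matrix 0 _ _]mxE mulr0.
Qed.

Lemma mem_coset x z : (z \in code_coset D x) = (z - x \in D).
Proof.
apply/imsetP/idP => [[c Dc ->]|Dzx]; first by rewrite addrC addKr.
by exists (z - x); rewrite // addrC subrK.
Qed.

Lemma code_coset_eq x y : (code_coset D x == code_coset D y) = (x - y \in D).
Proof.
apply/eqP/idP => [e|Dxy].
  by rewrite -mem_coset -e mem_coset subrr dual0.
apply/setP=> z; rewrite !mem_coset; apply/idP/idP => Dz.
  by rewrite -(subrK x z) -addrA dualD.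
by rewrite -(subrK y z) -addrA dualD // -opprB dualN.
Qed.

Lemma cosetsP x : code_coset D x \in code_cosets D.
Proof. exact: imset_f. Qed.

Definition vertex (x : 'rV[R]_n) : coset_vertex D :=
  exist (fun X => X \in code_cosets D) (code_coset D x) (cosetsP x).

Lemma vertex_surj X : exists x, X = vertex x.
Proof.
by have /imsetP[x _ Xx] := valP X; exists x; apply: val_inj.
Qed.

Lemma vertex_eq x y : (vertex x == vertex y) = (x - y \in D).
Proof. by rewrite -val_eqE /= code_coset_eq. Qed.

Lemma regular_coord i : exists t : 'rV[R]_l, (t *m G) 0 i = 1.
Proof.
have /imsetP[t _ e] : 1 \in [set (x *m col i G) 0 0 | x in [set: 'rV[R]_l]].
  by rewrite G_reg inE.
by exists t; rewrite e !mxE; apply: eq_bigr => j _; rewrite mxE.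
Qed.

Lemma dual_unit_multiple (u : R) (i : 'I_n) : u *: delta_mx 0 i \in D -> u = 0.
Proof.
move=> /mem_dualP h; have [t ti] := regular_coord i.
by have := h t; rewrite pairing_delta ti mulr1.
Qed.

(** If u e_i and v e_j agree modulo the dual code, then u g_i = v g_j for the
    columns of G.  Hence g_i and g_j generate the same submodule, so i = j by
    projectivity, and evaluating at a codeword with i-th coordinate 1 gives
    u = v. *)
Lemma unit_multiples_distinct (u v : R) (i j : 'I_n) :
    u \is a GRing.unit -> v \is a GRing.unit ->
    u *: delta_mx 0 i - v *: delta_mx 0 j \in D -> (u, i) = (v, j).
Proof.
move=> uu uv Duv.
have e (t : 'rV[R]_l) : u * (t *m G) 0 i = v * (t *m G) 0 j.
  apply/eqP; rewrite -subr_eq0 -!pairing_delta -pairingNr -pairingDr.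
  by rewrite (mem_dualP _ Duv).
suff ij : i = j.
  rewrite -ij in Duv *; rewrite -scalerBl in Duv.
  by have /eqP := dual_unit_multiple Duv; rewrite subr_eq0 => /eqP->.
have cols : u *: col i G = v *: col j G.
  apply/matrixP=> a b; have := e (delta_mx 0 a).
  by rewrite -!rowE !mxE.
apply/eqP/negPn/negP=> /G_proj[]; apply/setP=> y.
have dir (u' v' : R) i' j' : u' \is a GRing.unit ->
    u' *: col i' G = v' *: col j' G ->
    y \in [set a *: col i' G | a in [set: R]] ->
    y \in [set a *: col j' G | a in [set: R]].
  move=> uu' e' /imsetP[a _ ->]; apply/imsetP; exists (a * u'^-1 * v') => //.
  by rewrite -[RHS]scalerA -e' scalerA mulrVK.
by apply/idP/idP; [apply: dir uu cols | apply: dir uv (esym cols)].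
Qed.

Lemma coset_diff x z :
  [set a - b | a in code_coset D x, b in code_coset D z] = code_coset D (x - z).
Proof.
apply/setP=> w; rewrite mem_coset; apply/imset2P/idP => [[a b]|Dw].
  rewrite !mem_coset => Da Db ->.
  by rewrite opprD opprK addrACA [- b + z]addrC -[z - b]opprB dualD ?dualN.
exists (w + z) z; rewrite ?mem_coset ?subrr ?dual0 ?addrK //.
by rewrite addrAC -addrA [- x + z]addrC -[z - x]opprB.
Qed.

(** Adjacency is an existential statement; since at most one pair (u, i) is a
    witness, it equals the number of witnesses.  The sign change u |-> -u only
    serves to write the neighbours of x as x + u e_i. *)
Lemma coset_adj_sum x (Z : coset_vertex D) :
  coset_adj (vertex x) Z
  = (\sum_(p : R * 'I_n | p.1 \is a GRing.unit)
       (Z == vertex (x + p.1 *: delta_mx 0 p.2)%R))%N :> nat.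
Proof.
have [z ->{Z}] := vertex_surj Z; rewrite /coset_adj /= coset_diff.
case: existsP => [[u /existsP[i /andP[uu]]]|nadj].
  rewrite code_coset_eq => Dxz.
  rewrite (bigD1 (- u, i)) /= ?unitrN // big1 ?addn0 => [|[v j] /=].
    by rewrite vertex_eq scaleNr -[z - _]opprB addrAC dualN.
  case/andP=> uv; apply: contraNeq; rewrite eqb0 negbK vertex_eq => Dzx.
  apply/eqP; apply: unit_multiples_distinct; rewrite ?unitrN //.
  have -> : v *: delta_mx 0 j - - u *: delta_mx 0 i
      = - (x - z - u *: delta_mx 0 i + (z - (x + v *: delta_mx 0 j))).
    rewrite scaleNr opprK [- (x + _)]opprD [z + _]addrA -[z - x]opprB.
    by rewrite addrACA addrN add0r -opprD opprK addrC.
  exact/dualN/dualD.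
rewrite big1 // => -[u i] /= uu; apply/eqP; rewrite eqb0 vertex_eq.
apply/negP=> Dz; apply: nadj; exists (- u); apply/existsP; exists i.
rewrite unitrN uu /= code_coset_eq scaleNr opprK addrAC.
by rewrite -[_ - z]opprB dualN.
Qed.

(** Orthogonality of characters: when z is not in the dual code, some pairing
    t0 . z is nonzero, and a multiple of t0 has a nontrivial character value. *)
Lemma sum_char_pairing z :
  \sum_(t : 'rV[R]_l) chi (pairing t z)
    = if z \in D then #|{: 'rV[R]_l}|%:R else 0.
Proof.
case: ifPn => [/mem_dualP Dz|].
  by rewrite (eq_bigr (fun=> 1)) ?sumr_const // => t _; rewrite Dz.
rewrite inE => /forall_inPn[_ /imsetP[t0 _ ->] t0z].
have [a at0] := chi_gen t0z.
rewrite -[RHS](@sum_char_eq0 _ [set: 'rV[R]_l] (fun t => chi (pairing t z))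
                 (a *: t0)).
- by apply: eq_bigl => t; rewrite inE.
- by move=> t t'; rewrite pairingDl chiD.
- by move=> t; rewrite !inE.
- by rewrite pairingZl.
Qed.

(** * Walks and eigenvalues *)

Variable b : nat.

(** The eigenvalue, on the character of R^n / C^perp given by the codeword c, of
    the coset graph with b loops at each vertex. *)
Definition eigenvalue (c : 'rV[R]_n) : algC :=
  \sum_(p : R * 'I_n | p.1 \is a GRing.unit) chi (p.1 * c 0 p.2) + b%:R.

(** By induction on m: for m = 0 this is orthogonality.  The first step of a
    walk leads to x + u e_i or is one of the b loops, and moving x by u e_i
    multiplies the t-th term by chi (u (t G)_i). *)
Lemma walks_spectral m x y :
  #|{: 'rV[R]_l}|%:R
      * (walks (add_loops b (coset_graph D)) m (vertex x) (vertex y))%:R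
    = \sum_(t : 'rV[R]_l) eigenvalue (t *m G) ^+ m * chi (pairing t (x - y)).
Proof.
elim: m x => [|m IHm] x /=.
  under eq_bigr do rewrite expr0 mul1r.
  rewrite sum_char_pairing vertex_eq.
  by case: ifP; rewrite ?mulr1 ?mulr0.
set W := walks _ _ in IHm *.
have -> : (\sum_Z add_loops b (coset_graph D) (vertex x) Z * W Z (vertex y)
  = \sum_(p : R * 'I_n | p.1 \is a GRing.unit)
      W (vertex (x + p.1 *: delta_mx 0 p.2)%R) (vertex y)
    + b * W (vertex x) (vertex y))%N.
  under eq_bigr do rewrite mulnDl.
  rewrite big_split /=; congr (_ + _)%N; last first.
    rewrite (bigD1 (vertex x)) //= eqxx big1 ?addn0 // => Z.
    by rewrite eq_sym => /negPf ->.
  under eq_bigr do rewrite /coset_graph coset_adj_sum big_distrl /=.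
  rewrite exchange_big; apply: eq_bigr => p _ /=.
  rewrite (bigD1 (vertex (x + p.1 *: delta_mx 0 p.2))) //= eqxx mul1n.
  by rewrite big1 ?addn0 // => Z /negPf ->.
rewrite natrD natr_sum natrM mulrDr mulr_sumr [X in _ + X]mulrCA IHm.
rewrite (eq_bigr _ (fun p _ => IHm _)).
rewrite exchange_big mulr_sumr -big_split /=; apply: eq_bigr => t _.
rewrite exprSr /eigenvalue -/(eigenvalue _) -mulrA.
rewrite [X in _ = _ * X]mulrDl mulrDr; congr (_ + _); last by rewrite mulrCA.
rewrite mulr_suml mulr_sumr; apply: eq_bigr => p _; congr (_ * _).
by rewrite addrAC (pairingDr _ (x - y)) pairing_delta chiD mulrC.
Qed.

Lemma coset_adj_irrefl (X : coset_vertex D) : coset_adj X X = false.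
Proof.
have [x ->] := vertex_surj X; apply/existsP=> -[u /existsP[i /andP[uu]]].
rewrite /= coset_diff subrr code_coset_eq sub0r => /dualN.
rewrite opprK => /dual_unit_multiple u0.
by rewrite u0 unitr0 in uu.
Qed.

(** The entries of M^m - tau M have Fourier coefficients only at the messages t
    with t G = 0, where the character is identically 1; so they are all equal to
    one integer a0, and the number of walks is a0 + tau * M X Y. *)
Lemma SWRG_of_eigenvalues m tau :
    (forall c, c \in code_of G -> c != 0 ->
       eigenvalue c ^+ m = tau%:R * eigenvalue c) ->
  is_SWRG m (add_loops b (coset_graph D)).
Proof.
move=> eigP; set M := add_loops b _.
pose a X Y : int := (walks M m X Y)%:Z - (tau * M X Y)%:Z.
have walks1 X Y : walks M 1 X Y = M X Y.
  rewrite /= (bigD1 Y) //= eqxx muln1 big1 ?addn0 // => Z /negPf->.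
  by rewrite muln0.
have N0 : #|{: 'rV[R]_l}|%:R != 0 :> algC.
  by rewrite pnatr_eq0 -lt0n; apply/card_gt0P; exists 0.
have aE X Y : #|{: 'rV[R]_l}|%:R * (a X Y)%:~R
    = \sum_(t : 'rV[R]_l | t *m G == 0)
        (eigenvalue 0 ^+ m - tau%:R * eigenvalue 0).
  have [[x ->] [y ->]] := (vertex_surj X, vertex_surj Y).
  (* M counts the walks of length 1, so both terms have an expansion. *)
  rewrite /a rmorphB /= -!pmulrn mulrBr natrM mulrCA -walks1 !walks_spectral.
  rewrite mulr_sumr -sumrB [RHS]big_mkcond; apply: eq_bigr => t _.
  rewrite expr1 mulrA -mulrBl; case: ifPn => [/eqP tG|tG].
    suff -> : pairing t (x - y) = 0 by rewrite tG chi0 mulr1.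
    by rewrite /pairing tG big1 // => i _; rewrite mxE mul0r.
  by rewrite eigP ?subrr ?mul0r //; apply: imset_f.
have a_const X Y X' Y' : a X Y = a X' Y'.
  by apply: (@intr_inj algC); apply: (mulfI N0); rewrite !aE.
pose a0 := a (vertex 0) (vertex 0).
have walksE X Y : walks M m X Y = absz (a0 + (tau * M X Y)%:Z).
  by rewrite /a0 (a_const _ _ X Y) subrK.
exists (absz (a0 + tau%:Z)), (absz a0), (absz (a0 + (tau * b)%:Z)) => X Y.
rewrite walksE /M /add_loops /coset_graph.
case: eqVneq => [->|_]; first by rewrite coset_adj_irrefl add0n.
by case: coset_adj; rewrite addn0 ?muln1 ?muln0 ?addr0.
Qed.

End CosetGraph.

Section EigenvaluesOfWeights.
Local Open Scope ring_scope.

Lemma eigenvalue_whomv (q n b : nat) (R : finComUnitRingType)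
    (chi : R -> algC) (c : 'rV[R]_n) :
    depth2_chain_ring q R -> chi 0 = 1 ->
    (forall x y, chi (x + y) = chi x * chi y) -> chi 2%:R = -1 ->
  eigenvalue chi b c = (n * (q * (q - 1)))%:R - (q * whomv q c)%:R + b%:R.
Proof.
move=> R_chain chi0 chiD chi2; congr (_ + _).
transitivity (\sum_(i < n) \sum_(u : R | u \is a GRing.unit) chi (u * c 0 i)).
  rewrite exchange_big pair_big_dep /=.
  by apply: eq_bigl => p; rewrite andbT.
rewrite (eq_bigr _ (fun i _ => sum_char_units R_chain chi0 chiD chi2 (c 0 i))).
rewrite sumrB sumr_const card_ord -mulrnA [(n * _)%N]mulnC; congr (_ - _).
by rewrite -natr_sum -big_distrr.
Qed.

End EigenvaluesOfWeights.

Theorem mainTheorem6 (r k s n l : nat) (R : finComUnitRingType)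
    (G : 'M[R]_(l, n)) :
  1 <= r ->
  2 <= k ->
  admissible k r s ->
  is_GR4 r R ->
  n = 2 ^ s * (((2 ^ r) ^ k - 1) %/ (2 ^ r - 1)) ->
  regular_gen G ->
  projective_gen G ->
  teichmuller_weights r k s (code_of G) ->
  is_SWRG 3 (add_loops (2 ^ s * 2 ^ r) (coset_graph (dual_code (code_of G)))).
Proof.
move=> r_gt0 _ _ R_GR4 n_def G_reg G_proj [weights _ _ _].
have R_chain := GR4_depth2_chain_ring R_GR4.
have [chi [chi0 chiD chi2]] := GR4_character R_GR4.
have chi_gen := char_generating R_chain chi2.
set q := 2 ^ r in n_def weights R_chain *.
set h := half_pow r s (k - 1) in weights.
have q_gt1 : 1 < q by rewrite -(expn0 2) ltn_exp2l.
(* Keeps the smallest weight, a difference of natural numbers, from being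
   truncated. *)
have h_le : h <= 2 ^ s * q ^ k.
  rewrite /h /half_pow -expnM -expnD leq_exp2l //.
  rewrite leq_half_double; apply: (@leq_trans (s + r * k)).
    by rewrite leq_add2l leq_mul2l leq_subr orbT.
  by rewrite -addnn leqW ?leq_addr.
have n_q : n * (q - 1) = 2 ^ s * (q ^ k - 1).
  rewrite n_def -mulnA divnK //.
  by rewrite !subn1 predn_exp dvdn_mulr.
(* q * h is the absolute value of the nonzero eigenvalues. *)
apply: (SWRG_of_eigenvalues chi0 chiD chi_gen G_reg G_proj
          (tau := (q * h) ^ 2)).
move=> c Cc c0; set th := eigenvalue chi _ c.
have thE : th = ((q * (2 ^ s * q ^ k))%:R - (q * whomv q c)%:R)%R.
  rewrite /th (eigenvalue_whomv _ _ R_chain chi0 chiD chi2) addrAC -natrD.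
  rewrite mulnCA n_q [2 ^ s * q]mulnC -mulnDr.
  by rewrite -mulnSr subn1 prednK // expn_gt0 (ltnW q_gt1).
have : th \in [:: 0; (q * h)%:R; - (q * h)%:R]%R.
  have := weights c Cc c0; rewrite thE !inE => /or3P[] /eqP->.
  - by rewrite mulnBr natrB ?leq_mul // opprB addrC subrK eqxx !orbT.
  - by rewrite subrr eqxx.
  - by rewrite mulnDr natrD opprD addrA subrr sub0r eqxx !orbT.
rewrite !inE => /or3P[] /eqP->.
- by rewrite expr0n mulr0.
- by rewrite exprS natrX mulrC.
- by rewrite exprS sqrrN natrX mulrC.
Qed.
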